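(* Let $\mathfrak{T}$ and $\mathfrak{S}$ be $\mathcal{L}$-trees and let $a,b\in T$ and $c,d\in S$ with $a<_{\mathfrak{T}}b$ and $c<_{\mathfrak{S}}d$ be such that $\left(\mathfrak{T}_{\mathsf{cs}}^{(a,b)};(a,b)\right)\equiv^n\left(\mathfrak{S}_{\mathsf{cs}}^{(c,d)};(c,d)\right)$ and $(\mathfrak{T};b)\equiv^{n+1}(\mathfrak{S};d)$. Then $\left(\mathfrak{T}_{\mathsf{cs}}^{(a,b]};(a,b]\right)\equiv^n\left(\mathfrak{S}_{\mathsf{cs}}^{(c,d]};(c,d]\right)$.
   Context: A tree is a structure $\mathfrak{T}=(T;<)$ with $T$ non-empty and $<$ a strict partial order that is downwards linear (each set $\{x : x \leqslant t\}$ is totally ordered) and downwards connected (for all $s,t$ there is $x$ with $x\leqslant s$ and $x\leqslant t$). The language $\mathcal{L}$ consists of $=$, $<$ and finitely many constants and unary predicates; an $\mathcal{L}$-tree is a tree in this language. $(\mathfrak{T};a)$ and $(\mathfrak{T};A)$ denote expansions by a constant $a$, respectively a unary predicate $A$. $(a,b)=\{x : a<x<b\}$ and $(a,b]=\{x : a<x\leqslant b\}$. $\equiv^n$ denotes agreement on all first-order sentences of quantifier rank at most $n$ ($n$ a natural number, possibly $0$). For $a\in T$ the co-forest of $a$ has underlying set $T_{\mathsf{cf}}^{a}=\{x\in T : a\not<x\text{ and } y<x\text{ for all }y<a\}$. For $a<b$, the open cross section $\mathfrak{T}_{\mathsf{cs}}^{(a,b)}$ is the restriction of $\mathfrak{T}$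 to $T_{\mathsf{cs}}^{(a,b)}=\{x\in T : a<x,\ b\not<x,\ x\notin T_{\mathsf{cf}}^{b}\}$, and the closed cross section $\mathfrak{T}_{\mathsf{cs}}^{(a,b]}$ is the restriction of $\mathfrak{T}$ to $T_{\mathsf{cs}}^{(a,b]}=T_{\mathsf{cs}}^{(a,b)}\cup T_{\mathsf{cf}}^{b}=\{x\in T : a<x,\ b\not<x\}$. When a tree is restricted to a subset, constants of the language lying outside the subset are dropped; $n$-equivalence of two restrictions includes that the same constants are retained in both. Restrictions may be empty. *)

(* Defs.v *)
From mathcomp Require Import all_boot.
From mathcomp Require Import boolp classical_sets.
From Stdlib Require Import RelationClasses.

Set Implicit Arguments.
Unset Strict Implicit.
Unset Printing Implicit Defensive.

Local Open Scope classical_set_scope.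

(* The symbols of a language besides [=] and [<]. *)
Record language := Language {
  consts : finType;
  upreds : finType
}.

(* A constant is interpreted by [None] when it has been dropped by a
   restriction. Carriers may be empty. *)
Record structure (L : language) := Structure {
  carrier :> Type;
  prec : carrier -> carrier -> Prop;
  cst : consts L -> option carrier;
  upred : upreds L -> set carrier
}.
Arguments prec {L s}.
Arguments cst {L} s.
Arguments upred {L} s.

Notation "x ≺ y" := (prec x y) (at level 70, no associativity).
Notation "x ≼ y" := (prec x y \/ x = y) (at level 70, no associativity).

Inductive term (L : language) (k : nat) :=
  | Var of 'I_k
  | Cst of consts L.
Arguments Cst {L k}.

(* [formula L k]: first-order formulas with free variables in ['I_k]. A
   quantifier binds the variable [ord0] of its body. *)
Inductive formula (L : language) : nat -> Type :=
  | Bot k : formula L k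
  | Eq k : term L k -> term L k -> formula L k
  | Prec k : term L k -> term L k -> formula L k
  | Upred k : upreds L -> term L k -> formula L k
  | Imp k : formula L k -> formula L k -> formula L k
  | And k : formula L k -> formula L k -> formula L k
  | Or k : formula L k -> formula L k -> formula L k
  | All k : formula L k.+1 -> formula L k
  | Ex k : formula L k.+1 -> formula L k.

Definition sentence (L : language) := formula L 0.

Fixpoint qrank L k (f : formula L k) : nat :=
  match f with
  | Bot _ | Eq _ _ _ | Prec _ _ _ | Upred _ _ _ => 0
  | Imp _ g h | And _ g h | Or _ g h => maxn (qrank g) (qrank h)
  | All _ g | Ex _ g => (qrank g).+1
  end.

Definition term_over L k (D : pred (consts L)) (t : term L k) : bool :=
  if t is Cst c then D c else true.

Fixpoint formula_over L k (D : pred (consts L)) (f : formula L k) : bool :=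
  match f with
  | Bot _ => true
  | Eq _ t u | Prec _ t u => term_over D t && term_over D u
  | Upred _ _ t => term_over D t
  | Imp _ g h | And _ g h | Or _ g h => formula_over D g && formula_over D h
  | All _ g | Ex _ g => formula_over D g
  end.

Definition eval L (M : structure L) k (t : term L k) (e : k.-tuple M) :
    option M :=
  match t with
  | Var i => Some (tnth e i)
  | Cst c => cst M c
  end.

(* Atomic formulas mentioning a dropped constant are given the value [False];
   [nequiv] below never looks at such formulas. *)
Fixpoint sat L (M : structure L) k (f : formula L k) : k.-tuple M -> Prop :=
  match f with
  | Bot _ => fun=> False
  | Eq _ t u => fun e =>
      if (eval t e, eval u e) is (Some x, Some y) then x = y else False
  | Prec _ t u => fun e =>
      if (eval t e, eval u e) is (Some x, Some y) then x ≺ y else False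
  | Upred _ p t => fun e =>
      if eval t e is Some x then upred M p x else False
  | Imp _ g h => fun e => sat g e -> sat h e
  | And _ g h => fun e => sat g e /\ sat h e
  | Or _ g h => fun e => sat g e \/ sat h e
  | All _ g => fun e => forall x : M, sat g [tuple of x :: e]
  | Ex _ g => fun e => exists x : M, sat g [tuple of x :: e]
  end.

Definition models L (M : structure L) (f : sentence L) : Prop :=
  sat f ([tuple] : 0.-tuple M).

Definition retained L (M : structure L) : pred (consts L) :=
  fun c => isSome (cst M c).

Definition nequiv L (n : nat) (M N : structure L) : Prop :=
  retained M =1 retained N /\
  forall f : sentence L, qrank f <= n -> formula_over (retained M) f ->
    (models M f <-> models N f).

Definition add_const_lang (L : language) : language :=
  Language (option (consts L)) (upreds L).

Definition add_const L (M : structure L) (a : M) :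
    structure (add_const_lang L) :=
  @Structure (add_const_lang L) M prec (fun c => oapp (cst M) (Some a) c)
    (upred M).

Definition add_pred_lang (L : language) : language :=
  Language (consts L) (option (upreds L)).

Definition add_pred L (M : structure L) (A : set M) :
    structure (add_pred_lang L) :=
  @Structure (add_pred_lang L) M prec (cst M) (fun p => oapp (upred M) A p).

Definition restrict L (M : structure L) (A : set M) : structure L :=
  @Structure L (set_type A) (fun x y => val x ≺ val y)
    (fun c => obind insub (cst M c)) (fun p => val @^-1` upred M p).

(* [(M restricted to A; B)], where [B] is given as a subset of [M]. *)
Definition restrict_with L (M : structure L) (A B : set M) :
    structure (add_pred_lang L) :=
  @add_pred L (restrict A) (val @^-1` B).

(* All constants are interpreted in an L-tree. *)
Record is_Ltree L (T : structure L) : Prop := IsLtree {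
  tree_nonempty : inhabited T;
  tree_order : StrictOrder (@prec L T);
  tree_down_linear : forall t x y : T, x ≼ t -> y ≼ t -> x ≼ y \/ y ≼ x;
  tree_down_connected : forall s t : T, exists x : T, x ≼ s /\ x ≼ t;
  tree_consts : forall c, retained T c
}.

Section CrossSections.
Context {L : language} {T : structure L}.
Implicit Types a b x y : T.

Definition itv_oo a b : set T := [set x | a ≺ x /\ x ≺ b].

Definition itv_oc a b : set T := [set x | a ≺ x /\ x ≼ b].

Definition coforest a : set T :=
  [set x | ~ a ≺ x /\ forall y, y ≺ a -> y ≺ x].

Definition cs_oo a b : set T :=
  [set x | [/\ a ≺ x, ~ b ≺ x & ~ coforest b x]].

Definition cs_oc a b : set T := cs_oo a b `|` coforest b.

Lemma cs_ocE a b : a ≺ b -> cs_oc a b = [set x | a ≺ x /\ ~ b ≺ x].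
Proof.
move=> ab; apply/seteqP; split=> x /=.
  by case=> [[ax bx _]|[bx h]]; split=> //; apply: h.
move=> [ax bx]; have [h|h] := pselect (coforest b x); first by right.
by left; split.
Qed.

Lemma itv_oo_sub a b : is_Ltree T -> itv_oo a b `<=` cs_oo a b.
Proof.
move=> [_ [irr trans] _ _ _] x [ax xb]; split=> // [bx|[_ h]].
  exact: (irr b (trans _ _ _ bx xb)).
exact: (irr x (h _ xb)).
Qed.

Lemma itv_oc_sub a b : is_Ltree T -> a ≺ b -> itv_oc a b `<=` cs_oc a b.
Proof.
move=> [_ [irr trans] _ _ _] ab x; rewrite cs_ocE// => -[ax xb]; split=> // bx.
case: xb => [xb|xb]; last by apply: (irr b); rewrite -{2}xb.
exact: (irr b (trans _ _ _ bx xb)).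
Qed.

End CrossSections.

(* Main.v *)
(* The argument is an Ehrenfeucht-Fraisse game. The closed cross section is the
   disjoint union of the open one and of the coforest of [b], and the order
   between a point [x] of the former and a point [z] of the latter is determined
   by the predicate [(a, b)]: [x ≺ z] iff [x] lies in [(a, b)], and never
   [z ≺ x]. Duplicator answers moves in the open cross section by the first
   equivalence and moves in the coforest by the second one. Belonging to the
   coforest of [b] is a condition of quantifier rank 1, so the spare round of the
   second game forces these answers into the coforest of [d]. *)
Require Import Defs.
From mathcomp Require Import all_boot.
From mathcomp Require Import boolp classical_sets.
From Stdlib Require List.

Set Implicit Arguments.
Unset Strict Implicit.
Unset Printing Implicit Defensive.

Local Open Scope classical_set_scope.

(** * Ehrenfeucht-Fraisse games and elementary equivalence of bounded rank *)

Section BackAndForth.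
Context {L : language}.
Implicit Types M N : structure L.

Definition extend (A B : Type) (R : A -> B -> Prop) (x : A) (y : B) :
    A -> B -> Prop :=
  fun u v => R u v \/ (u = x /\ v = y).

(** Positions are relations rather than pairs of tuples, so that positions of different games can be
    merged. The clause on equality makes them functional and injective. *)
Definition partial_iso M N (R : M -> N -> Prop) : Prop :=
  (forall x y x' y', R x y -> R x' y' ->
     (x = x' <-> y = y') /\ (x ≺ x' <-> y ≺ y')) /\
  (forall x y p, R x y -> (upred M p x <-> upred N p y)).

(* Duplicator wins the [n]-round game from the position [R]. *)
Fixpoint ef n M N (R : M -> N -> Prop) : Prop :=
  partial_iso R /\
  if n is m.+1 then
    (forall x, exists y, ef m (extend R x y)) /\
    (forall y, exists x, ef m (extend R x y))
  else True.

Lemma ef_partial_iso n M N (R : M -> N -> Prop) : ef n R -> partial_iso R.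
Proof. by case: n => [|n] []. Qed.

Lemma ef_pred n M N (R : M -> N -> Prop) : ef n.+1 R -> ef n R.
Proof.
elim: n R => [|n IHn] R [isoR [forth back]]; first by split.
split=> //; split=> [x|y].
  by have [y /IHn] := forth x; exists y.
by have [x /IHn] := back y; exists x.
Qed.

Lemma ef_le m n M N (R : M -> N -> Prop) : m <= n -> ef n R -> ef m R.
Proof.
move/subnK <-; elim: (n - m) => [//|k IHk]; rewrite addSn => /ef_pred.
exact: IHk.
Qed.

(** With fewer pairs to respect, the same answers still win. This lets positions be compared by
    inclusion, without proving relations equal. *)
Lemma ef_sub n M N (R R' : M -> N -> Prop) :
  (forall x y, R x y -> R' x y) -> ef n R' -> ef n R.
Proof.
elim: n R R' => [|n IHn] R R' sRR' /=.
  case=> -[ord un] _; split=> //.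
  split=> [x y x' y' /sRR' xy /sRR' xy'|x y p /sRR' xy]; first exact: ord.
  exact: un.
have sE x y u v : extend R x y u v -> extend R' x y u v.
  by case=> [/sRR'|]; [left|right].
case=> -[ord un] [forth back]; split.
  split=> [x y x' y' /sRR' xy /sRR' xy'|x y p /sRR' xy]; first exact: ord.
  exact: un.
split=> [x|y].
  by have [y /(IHn _ _ (sE x y))] := forth x; exists y.
by have [x /(IHn _ _ (sE x y))] := back y; exists x.
Qed.

(** Terms include constants, so a constant with a value on both sides contributes a pair before any
    move is made. *)
Definition matched M N k (e : k.-tuple M) (e' : k.-tuple N) :
    M -> N -> Prop :=
  fun x y => exists t : term L k, eval t e = Some x /\ eval t e' = Some y.

Lemma matched_cons M N k (e : k.-tuple M) (e' : k.-tuple N) x y u v :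
  matched [tuple of x :: e] [tuple of y :: e'] u v <->
  extend (matched e e') x y u v.
Proof.
split.
  case=> -[i|c] /= [].
    case: (unliftP ord0 i) => [j ->|->].
      by rewrite !tnthS => eu ev; left; exists (Var _ j).
    by rewrite !tnth0 => -[<-] [<-]; right.
  by move=> eu ev; left; exists (Cst c).
case=> [[[i|c] /= [eu ev]]|[-> ->]].
- by exists (Var _ (lift ord0 i)); rewrite /= !tnthS.
- by exists (Cst c).
- by exists (Var _ ord0).
Qed.

Lemma eval_over M (D : pred (consts L)) k (t : term L k) (e : k.-tuple M) :
  retained M =1 D -> term_over D t -> exists x, eval t e = Some x.
Proof.
move=> MD; case: t => [i|c] /=; first by exists (tnth e i).
by rewrite -MD /retained; case: (cst M c) => // x; exists x.
Qed.

Lemma over_eval M (D : pred (consts L)) k (t : term L k) (e : k.-tuple M) x :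
  retained M =1 D -> eval t e = Some x -> term_over D t.
Proof. by move=> MD; case: t => [//|c] /= ex; rewrite -MD /retained ex. Qed.

(** Each quantifier costs one round. Since [f] only mentions constants of [D], all its terms have
    values on both sides, and the atomic cases never meet the default [False]. *)
Lemma ef_sat M N (D : pred (consts L)) k (f : formula L k) n
    (e : k.-tuple M) (e' : k.-tuple N) :
  retained M =1 D -> retained N =1 D -> qrank f <= n -> formula_over D f ->
  ef n (matched e e') -> (sat f e <-> sat f e').
Proof.
move=> MD ND; elim: f n e e' => {k} [k|k t u|k t u|k p t
    |k g IHg h IHh|k g IHg h IHh|k g IHg h IHh|k g IHg|k g IHg] n e e' /=.
- by [].
- move=> _ /andP[tD uD] /ef_partial_iso [ord _].
  have [x ex] := eval_over e MD tD; have [x' ex'] := eval_over e' ND tD.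
  have [y ey] := eval_over e MD uD; have [y' ey'] := eval_over e' ND uD.
  by rewrite ex ex' ey ey'; have [] := ord x x' y y'; [exists t|exists u|].
- move=> _ /andP[tD uD] /ef_partial_iso [ord _].
  have [x ex] := eval_over e MD tD; have [x' ex'] := eval_over e' ND tD.
  have [y ey] := eval_over e MD uD; have [y' ey'] := eval_over e' ND uD.
  by rewrite ex ex' ey ey'; have [] := ord x x' y y'; [exists t|exists u|].
- move=> _ tD /ef_partial_iso [_ un].
  have [x ex] := eval_over e MD tD; have [x' ex'] := eval_over e' ND tD.
  by rewrite ex ex'; apply: un; exists t.
- rewrite geq_max => /andP[gn hn] /andP[gD hD] E.
  by have := IHg _ _ _ gn gD E; have := IHh _ _ _ hn hD E; tauto.
- rewrite geq_max => /andP[gn hn] /andP[gD hD] E.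
  by have := IHg _ _ _ gn gD E; have := IHh _ _ _ hn hD E; tauto.
- rewrite geq_max => /andP[gn hn] /andP[gD hD] E.
  by have := IHg _ _ _ gn gD E; have := IHh _ _ _ hn hD E; tauto.
- case: n => [//|n] gn gD [_ [forth back]].
  have step x y : ef n (extend (matched e e') x y) ->
      (sat g [tuple of x :: e] <-> sat g [tuple of y :: e']).
    move=> E; apply: (IHg n) => //; apply: ef_sub E => u v.
    by move/matched_cons.
  split=> H z.
    by have [x /step <-] := back z.
  by have [y /step ->] := forth z.
- case: n => [//|n] gn gD [_ [forth back]].
  have step x y : ef n (extend (matched e e') x y) ->
      (sat g [tuple of x :: e] <-> sat g [tuple of y :: e']).
    move=> E; apply: (IHg n) => //; apply: ef_sub E => u v.
    by move/matched_cons.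
  split=> -[z Hz].
    by have [y /step xy] := forth z; exists y; apply/xy.
  by have [x /step xy] := back z; exists x; apply/xy.
Qed.

(* The conjunctions that decide every formula of [s]. *)
Fixpoint complete_conjs k (s : seq (formula L k)) : seq (formula L k) :=
  if s is f :: s' then
    map (And f) (complete_conjs s') ++
    map (And (Imp f (Bot L k))) (complete_conjs s')
  else [:: Imp (Bot L k) (Bot L k)].

Lemma complete_conjs_bounded (D : pred (consts L)) n k
    (s : seq (formula L k)) :
  (forall f, List.In f s -> qrank f <= n /\ formula_over D f) ->
  forall g, List.In g (complete_conjs s) -> qrank g <= n /\ formula_over D g.
Proof.
elim: s => [_ g [<-|[]] //|f s IHs sP g].
have [fn fD] := sP f (or_introl erefl).
have {}IHs := IHs (fun g gs => sP g (or_intror gs)).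
move=> /(@List.in_app_or _ _ _ _)[] /List.in_map_iff[h [<- /IHs[hn hD]]] /=;
  by rewrite ?maxn0 geq_max fn hn fD hD.
Qed.

(** For each [f] in [s], the conjunct taken is [f] or its negation, whichever holds at [e]; hence
    [g] fixes the truth value of all of [s]. *)
Lemma complete_conjs_sat M k (s : seq (formula L k)) (e : k.-tuple M) :
  exists g, [/\ List.In g (complete_conjs s), sat g e &
    forall N (e' : k.-tuple N), sat g e' ->
      forall f, List.In f s -> (sat f e <-> sat f e')].
Proof.
elim: s => [|f s [g [gs ge gP]]].
  by exists (Imp (Bot L k) (Bot L k)); split=> //; left.
have [fe|fe] := pselect (sat f e).
  exists (And f g); split=> //.
    by apply: List.in_or_app; left; apply: List.in_map.
  by move=> N e' [fe' ge'] h [<-|/(gP _ _ ge')].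
exists (And (Imp f (Bot L k)) g); split=> //.
  by apply: List.in_or_app; right; apply: List.in_map.
by move=> N e' [fe' ge'] h [<-|/(gP _ _ ge')].
Qed.

Definition terms_over (D : pred (consts L)) k : seq (term L k) :=
  map (fun i => Var L i) (enum 'I_k) ++ map Cst (enum D).

Lemma in_map_eqType (A : eqType) B (g : A -> B) (s : seq A) x :
  x \in s -> List.In (g x) (map g s).
Proof.
elim: s => //= y s IHs; rewrite inE => /orP[/eqP->|/IHs]; first by left.
by right.
Qed.

Lemma mem_terms_over D k (t : term L k) :
  List.In t (terms_over D k) <-> term_over D t.
Proof.
split.
  move=> /(@List.in_app_or _ _ _ _)[] /List.in_map_iff[z [<- //]] /=.
  move=> zD; have : z \in enum D.
    by elim: (enum D) zD => //= y s IHs [->|/IHs]; rewrite inE ?eqxx// orbC => ->.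
  by rewrite mem_enum.
move=> tD; apply: List.in_or_app; case: t tD => [i|c] tD; [left|right].
  by apply: in_map_eqType; rewrite mem_enum.
by apply: in_map_eqType; rewrite mem_enum.
Qed.

Definition atoms (D : pred (consts L)) k : seq (formula L k) :=
  List.flat_map (fun t =>
    List.flat_map (fun u => [:: Eq t u; Prec t u]) (terms_over D k) ++
    map (fun p => Upred p t) (enum (upreds L))) (terms_over D k).

Lemma atoms_bounded D n k (f : formula L k) :
  List.In f (atoms D k) -> qrank f <= n /\ formula_over D f.
Proof.
move=> /List.in_flat_map[t [/mem_terms_over tD /(@List.in_app_or _ _ _ _)[]]].
  by move=> /List.in_flat_map[u [/mem_terms_over uD [<-|[<-|[]]]]] /=;
    rewrite tD uD.
by move=> /List.in_map_iff[p [<- _]].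
Qed.

Lemma atoms_partial_iso M N (D : pred (consts L)) k
    (e : k.-tuple M) (e' : k.-tuple N) :
  retained M =1 D ->
  (forall f, List.In f (atoms D k) -> (sat f e <-> sat f e')) ->
  partial_iso (matched e e').
Proof.
move=> MD H; split=> [x y x' y' [t [tx ty]] [u [ux uy]]|x y p [t [tx ty]]].
  have tD := over_eval MD tx; have uD := over_eval MD ux.
  have := H (Eq t u); have := H (Prec t u).
  rewrite /= tx ty ux uy => HP HE; split; [apply: HE|apply: HP];
    apply/List.in_flat_map; exists t; (split; first exact/mem_terms_over);
    apply: List.in_or_app; left; apply/List.in_flat_map; exists u;
    (split; first exact/mem_terms_over) => /=; tauto.
have tD := over_eval MD tx.
have := H (Upred p t); rewrite /= tx ty; apply.
apply/List.in_flat_map; exists t; split; first exact/mem_terms_over.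
apply: List.in_or_app; right.
by apply: (in_map_eqType (fun p => Upred p t)); rewrite mem_enum.
Qed.

(** Duplicator's answer must agree with Spoiler's point on all formulas of rank [n] at once.
    Finiteness of the language allows this: the behaviour of a point over [e] is summed up by one
    complete conjunction [g] of the basis for [k.+1] variables. Adding every such [Ex g] to the
    atoms gives the next basis, and a witness of [Ex g] on the other side is the answer. *)
Lemma finite_ef_basis (D : pred (consts L)) n k :
  exists2 s : seq (formula L k),
    forall f, List.In f s -> qrank f <= n /\ formula_over D f &
    forall M N (e : k.-tuple M) (e' : k.-tuple N),
      retained M =1 D -> retained N =1 D ->
      (forall f, List.In f s -> (sat f e <-> sat f e')) ->
      ef n (matched e e').
Proof.
elim: n k => [|n IHn] k.
  exists (atoms D k); first by move=> f /atoms_bounded.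
  by move=> M N e e' MD _ H; split=> //; apply: atoms_partial_iso H.
have [s sP sE] := IHn k.+1.
exists (atoms D k ++ map (@Ex L k) (complete_conjs s)).
  move=> f /(@List.in_app_or _ _ _ _)[/atoms_bounded //|].
  by move=> /List.in_map_iff[g [<- /(complete_conjs_bounded sP)]].
move=> M N e e' MD ND H.
have HA f : List.In f (atoms D k) -> (sat f e <-> sat f e').
  by move=> fA; apply: H; apply: List.in_or_app; left.
have HE g : List.In g (complete_conjs s) -> (sat (Ex g) e <-> sat (Ex g) e').
  by move=> gs; apply: H; apply: List.in_or_app; right; apply: List.in_map.
have step x y : (forall f, List.In f s ->
      (sat f [tuple of x :: e] <-> sat f [tuple of y :: e'])) ->
    ef n (extend (matched e e') x y).
  by move=> /(sE _ _ _ _ MD ND); apply: ef_sub => u v /matched_cons.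
split; first exact: atoms_partial_iso HA.
split=> [x|y].
  have [g [gs gx gP]] := complete_conjs_sat s [tuple of x :: e].
  have /(HE g gs) [y gy] : sat (Ex g) e by exists x.
  by exists y; apply: step; apply: gP.
have [g [gs gy gP]] := complete_conjs_sat s [tuple of y :: e'].
have /(HE g gs) [x gx] : sat (Ex g) e' by exists y.
by exists x; apply: step => f fs; apply: iff_sym; apply: gP.
Qed.

Lemma nequiv_ef n M N :
  nequiv n M N <->
  retained M =1 retained N /\ ef n (matched (M := M) (N := N) [tuple] [tuple]).
Proof.
split=> [[MN H]|[MN E]]; split=> //.
  have [s sP sE] := finite_ef_basis (retained M) n 0.
  by apply: sE => // f /sP[fn fD]; apply: H.
by move=> f fn fD; apply: (ef_sat _ _ fn fD E) => // c; rewrite MN.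
Qed.

End BackAndForth.

(** * How the open cross section and the coforest lie relative to each other *)

Section Tree.
Context {L : language} {T : structure L}.
Hypothesis hT : is_Ltree T.
Implicit Types a b x z : T.

Let irr x : ~ x ≺ x.
Proof. by have [irrT _] := tree_order hT; apply: irrT. Qed.

Let trans x y z : x ≺ y -> y ≺ z -> x ≺ z.
Proof. by have [_ transT] := tree_order hT; apply: transT. Qed.

Lemma coforest_self b : coforest b b.
Proof. by split=> [/irr|]. Qed.

Lemma coforest_itv_oc a b x : a ≺ b -> coforest b x -> (itv_oc a b x <-> x = b).
Proof.
move=> ab [_ bx]; split=> [[_ [/bx /irr|]] //|->].
by split=> //; right.
Qed.

Lemma cs_oo_itv_oc a b x : cs_oo a b x -> (itv_oc a b x <-> itv_oo a b x).
Proof.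
move=> [ax bx nx]; split=> -[_ xb]; split=> //; last by left.
by case: xb => // xb; case: nx; rewrite xb; apply: coforest_self.
Qed.

(** Suppose [x ≺ z] but not [x ≺ b]. Any [y ≺ b] is also below [z], hence comparable with [x]; as
    [x ≼ y] would put [x] below [b], it follows that [y ≺ x]. Then [x] lies in the coforest of [b],
    which the open section excludes. *)
Lemma cs_oo_prec_coforest a b x z :
  cs_oo a b x -> coforest b z -> (x ≺ z <-> itv_oo a b x).
Proof.
move=> [ax bx nx] [bz hz]; split=> [xz|[_ /hz] //]; split=> //.
apply: contrapT => nxb; apply: nx; split=> // y yb.
have [] := tree_down_linear hT (or_introl (hz y yb)) (or_introl xz).
  by case=> // yx; case: nxb; rewrite -yx.
by case=> [/trans/(_ yb)|xy]; [|case: nxb; rewrite xy].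
Qed.

(** Everything below [b] is below [z], so [z ≺ x] would place [x] in the coforest. *)
Lemma coforest_not_prec_cs_oo a b x z :
  cs_oo a b x -> coforest b z -> ~ z ≺ x.
Proof.
move=> [ax bx nx] [bz hz] zx; apply: nx; split=> // y /hz yz.
exact: trans yz zx.
Qed.

End Tree.

(** The condition [~ b ≺ x] is read off the position. For the other one, a point [v ≺ d] is played
    in the one round needed; its answer [u] is below [b], hence below [x], and so [v ≺ y]. The
    converse is symmetric. *)
Lemma ef_coforest (L : language) (T S : structure L) (b : T) (d : S) n
    (R : T -> S -> Prop) x y :
  ef n.+1 (R : add_const b -> add_const d -> Prop) -> R b d -> R x y ->
  (coforest b x <-> coforest d y).
Proof.
move=> /(@ef_le _ 1 n.+1 _ _ _ isT) [[ord _] [forth back]] bd xy.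
have [_ bx_dy] := ord _ _ _ _ bd xy.
split=> -[bx hx]; split; try by move=> /bx_dy.
  move=> v vd; have [u [[ord' _] _]] := back v.
  have uv : extend R u v u v by right.
  have [_ ub_vd] := ord' _ _ _ _ uv (or_introl bd).
  have [_ ux_vy] := ord' _ _ _ _ uv (or_introl xy).
  by apply/ux_vy/hx/ub_vd.
move=> u ub; have [v [[ord' _] _]] := forth u.
have uv : extend R u v u v by right.
have [_ ub_vd] := ord' _ _ _ _ uv (or_introl bd).
have [_ ux_vy] := ord' _ _ _ _ uv (or_introl xy).
by apply/ux_vy/hx/ub_vd.
Qed.

(** * Composing the two strategies *)

Section Composition.
Context {L : language} {T S : structure L} (a b : T) (c d : S).
Hypotheses (hT : is_Ltree T) (hS : is_Ltree S) (hab : a ≺ b) (hcd : c ≺ d).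

Local Notation Too := (restrict_with (cs_oo a b) (itv_oo a b)).
Local Notation Soo := (restrict_with (cs_oo c d) (itv_oo c d)).
Local Notation Toc := (restrict_with (cs_oc a b) (itv_oc a b)).
Local Notation Soc := (restrict_with (cs_oc c d) (itv_oc c d)).

(** The two restrictions have different carrier types, so points are compared through [val]. Pairs
    of [R2] must be filtered, since that game may hold points outside the coforests, such as values
    of constants. *)
Definition composed (R1 : Too -> Soo -> Prop) (R2 : T -> S -> Prop) :
    Toc -> Soc -> Prop :=
  fun u v =>
    (exists u1 v1, [/\ R1 u1 v1, val u1 = val u & val v1 = val v]) \/
    [/\ coforest b (val u), coforest d (val v) & R2 (val u) (val v)].

Lemma composed_partial_iso (R1 : Too -> Soo -> Prop) (R2 : T -> S -> Prop) :
  partial_iso R1 ->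
  partial_iso (R2 : add_const b -> add_const d -> Prop) -> R2 b d ->
  partial_iso (composed R1 R2).
Proof.
move=> [ord1 un1] [ord2 un2] bd; split.
  move=> u v u' v' [[x [y [xy xu yv]]]|[bu dv uv]]
                   [[x' [y' [xy' xu' yv']]]|[bu' dv' uv']].
  - have [eq1 lt1] := ord1 _ _ _ _ xy xy'; split.
      split=> [uu'|vv']; apply: val_inj.
        rewrite -yv -yv'; congr val; apply/eq1/val_inj.
        by rewrite xu xu' uu'.
      rewrite -xu -xu'; congr val; apply/eq1/val_inj.
      by rewrite yv yv' vv'.
    by move: lt1; rewrite /= xu xu' yv yv'.
  - have xoo : cs_oo a b (val u) by rewrite -xu; apply: set_valP.
    have yoo : cs_oo c d (val v) by rewrite -yv; apply: set_valP.
    split; first split=> [uu'|vv'].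
    + by case: xoo => _ _; rewrite uu'.
    + by case: yoo => _ _; rewrite vv'.
    (* [None] is the added predicate, the open interval, which decides whether [u] lies below the
       coforest point. *)
    have := un1 x y None xy; rewrite /= xu yv => itvE.
    have := cs_oo_prec_coforest hT xoo bu'.
    by have := cs_oo_prec_coforest hS yoo dv'; tauto.
  - have xoo : cs_oo a b (val u') by rewrite -xu'; apply: set_valP.
    have yoo : cs_oo c d (val v') by rewrite -yv'; apply: set_valP.
    split; first split=> [uu'|vv'].
    + by case: xoo => _ _; rewrite -uu'.
    + by case: yoo => _ _; rewrite -vv'.
    have := coforest_not_prec_cs_oo hT xoo bu.
    by have := coforest_not_prec_cs_oo hS yoo dv; split.
  - have [eq2 lt2] := ord2 _ _ _ _ uv uv'; split=> //.
    by split=> [uu'|vv']; apply/val_inj/eq2; [rewrite uu'|rewrite vv'].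
move=> u v p [[x [y [xy xu yv]]]|[bu dv uv]]; case: p => [p|] /=.
- by have := un1 x y (Some p) xy; rewrite /= xu yv.
- have xoo : cs_oo a b (val u) by rewrite -xu; apply: set_valP.
  have yoo : cs_oo c d (val v) by rewrite -yv; apply: set_valP.
  have := un1 x y None xy; rewrite /= xu yv => itvE.
  have := cs_oo_itv_oc hT xoo; have := cs_oo_itv_oc hS yoo.
  rewrite /preimage/=; tauto.
- exact: (un2 _ _ p uv).
(* On the coforest the half-open interval reduces to its endpoint, so preserving it amounts to
   matching [b] with [d]. *)
- have [eq2 _] := ord2 _ _ _ _ uv bd.
  have := coforest_itv_oc hT hab bu; have := coforest_itv_oc hS hcd dv.
  rewrite /preimage/=; tauto.
Qed.

(** Each move is answered in one of the two games, while the other gives up a round by [ef_pred].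
    The second game stays one round ahead, so after a coforest move it still has the round that
    [ef_coforest] needs. *)
Lemma composed_ef n (R1 : Too -> Soo -> Prop) (R2 : T -> S -> Prop) :
  ef n R1 -> ef n.+1 (R2 : add_const b -> add_const d -> Prop) -> R2 b d ->
  ef n (composed R1 R2).
Proof.
elim: n R1 R2 => [|n IHn] R1 R2 E1 E2 bd.
  by split=> //; apply: composed_partial_iso => //; apply: ef_partial_iso;
    [apply: E1|apply: E2].
split.
  by apply: composed_partial_iso => //; apply: ef_partial_iso;
    [apply: E1|apply: E2].
(* [move1] and [move2] treat a move in the open section and one in the coforest: the composed
   position after the move contains the old one and the new pair. *)
have move1 u1 v1 (u : Toc) (v : Soc) : ef n (extend R1 u1 v1) ->
    val u1 = val u -> val v1 = val v -> ef n (extend (composed R1 R2) u v).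
  move=> E1' uE vE; have := IHn _ _ E1' (ef_pred E2) bd; apply: ef_sub.
  move=> w z [[[x [y [xy xw yz]]]|wz]|[-> ->]].
  - by left; exists x, y; split=> //; left.
  - by right.
  - by left; exists u1, v1; split=> //; right.
have move2 (u : Toc) (v : Soc) :
    ef n.+1 (extend R2 (val u) (val v) : add_const b -> add_const d -> Prop) ->
    coforest b (val u) -> coforest d (val v) ->
    ef n (extend (composed R1 R2) u v).
  move=> E2' bu dv; have := IHn _ _ (ef_pred E1) E2' (or_introl bd).
  apply: ef_sub => w z [[wz|[bw dz wz]]|[-> ->]].
  - by left.
  - by right; split=> //; left.
  - by right; split=> //; right.
have [_ [forth1 back1]] := E1; have [_ [forth2 back2]] := E2.
split=> [u|v].
  case: (set_valP u) => [uoo|bu].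
    have [v1 E1'] := forth1 (exist _ (val u) (mem_set uoo)).
    have voc : cs_oc c d (val v1) by left; apply: set_valP.
    by exists (exist _ (val v1) (mem_set voc)); apply: move1 E1' _ _.
  have [y E2'] := forth2 (val u).
  have dy : coforest d y.
    by apply/(ef_coforest E2' (or_introl bd) (or_intror (conj erefl erefl))).
  have yoc : cs_oc c d y by right.
  by exists (exist _ y (mem_set yoc)); apply: move2.
case: (set_valP v) => [voo|dv].
  have [u1 E1'] := back1 (exist _ (val v) (mem_set voo)).
  have uoc : cs_oc a b (val u1) by left; apply: set_valP.
  by exists (exist _ (val u1) (mem_set uoc)); apply: move1 E1' _ _.
have [x E2'] := back2 (val v).
have bx : coforest b x.
  by apply/(ef_coforest E2' (or_introl bd) (or_intror (conj erefl erefl))).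
have xoc : cs_oc a b x by right.
by exists (exist _ x (mem_set xoc)); apply: move2.
Qed.

End Composition.

(** * Constants of the restrictions, and the conclusion *)

Lemma retained_restrict_with (L : language) (M : structure L) (A B : set M)
    (k : consts L) x :
  cst M k = Some x -> retained (restrict_with A B) k = `[< A x >].
Proof.
move=> kx; rewrite /retained /= kx /=.
case: insubP => [u Ax _|nAx] /=; first by rewrite asboolT//; apply/set_mem.
by rewrite asboolF// => /mem_set; apply/negP.
Qed.

Lemma cst_restrict_with (L : language) (M : structure L) (A B : set M)
    (k : consts L) x (u : restrict_with A B) :
  cst M k = Some x -> cst (restrict_with A B) k = Some u -> val u = x.
Proof. by move=> kx /=; rewrite kx /=; case: insubP => // w _ <- [->]. Qed.

Theorem proposition3p7 (L : language) (T S : structure L)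
    (hT : is_Ltree T) (hS : is_Ltree S) (a b : T) (c d : S) (n : nat)
    (hab : a ≺ b) (hcd : c ≺ d)
    (hcs : nequiv n (restrict_with (cs_oo a b) (itv_oo a b))
                    (restrict_with (cs_oo c d) (itv_oo c d)))
    (hbd : nequiv n.+1 (add_const b) (add_const d)) :
  nequiv n (restrict_with (cs_oc a b) (itv_oc a b))
           (restrict_with (cs_oc c d) (itv_oc c d)).
Proof.
have /nequiv_ef[ret1 E1] := hcs; have /nequiv_ef[_ E2] := hbd.
pose R2 : T -> S -> Prop :=
  matched (M := add_const b) (N := add_const d) [tuple] [tuple].
(* The constant [None] added to the language names [b] and [d]. *)
have bd : R2 b d by exists (@Cst (add_const_lang L) 0 None).
have R2cst k x y : cst T k = Some x -> cst S k = Some y -> R2 x y.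
  by move=> kx ky; exists (@Cst (add_const_lang L) 0 (Some k)).
have cstP k : exists x y, cst T k = Some x /\ cst S k = Some y.
  have := tree_consts hT k; have := tree_consts hS k; rewrite /retained.
  by case: (cst T k) (cst S k) => [x|] // [y|] // _ _; exists x, y.
(* Retaining the same constants means that each constant lies in both open sections or in
   neither. *)
have ooE k x y : cst T k = Some x -> cst S k = Some y ->
    (cs_oo a b x <-> cs_oo c d y).
  move=> kx ky; apply: asbool_eq_equiv.
  rewrite -(retained_restrict_with _ (itv_oo a b) kx).
  by rewrite -(retained_restrict_with _ (itv_oo c d) ky) ret1.
apply/nequiv_ef; split=> [k|].
  have [x [y [kx ky]]] := cstP k.
  rewrite (retained_restrict_with _ _ kx) (retained_restrict_with _ _ ky).
  apply: asbool_equiv_eq; rewrite /cs_oc /setU /=.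
  have := ef_coforest E2 bd (R2cst _ _ _ kx ky).
  by have := ooE _ _ _ kx ky; tauto.
(* It remains to see that the initial position of the closed game is contained in the composition of
   the two initial positions. *)
have := composed_ef hT hS hab hcd E1 E2 bd; apply: ef_sub => u v.
(* There are no variables at the start, so every pair comes from a retained constant [k], lying
   either in both open sections or in both coforests. *)
case=> -[[]//|k] [ku kv].
have [x [y [kx ky]]] := cstP k.
have xu := cst_restrict_with kx ku; have yv := cst_restrict_with ky kv.
case: (set_valP u) => [uoo|bu].
  have voo : cs_oo c d (val v).
    by rewrite yv; apply/(ooE _ _ _ kx ky); rewrite -xu.
  left; exists (exist _ (val u) (mem_set uoo)), (exist _ (val v) (mem_set voo)).
  split=> //; exists (Cst k); split; rewrite /= ?kx ?ky -?xu -?yv /=.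
    by rewrite (insubT (mem (cs_oo a b)) (mem_set uoo)).
  by rewrite (insubT (mem (cs_oo c d)) (mem_set voo)).
have uv : R2 (val u) (val v) by rewrite xu yv; apply: R2cst kx ky.
by right; split=> //; apply/(ef_coforest E2 bd uv).
Qed.
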